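(* Let $k\ge 2$ be an integer and let $$\mathscr{D}_{k,1}=(1+\varphi)^2\vartheta^{k+2}+3\varphi(1+\varphi)\vartheta^{k+1}+\varphi(1+2\varphi)\vartheta^k,\qquad \vartheta=\varphi\frac{d}{d\varphi}.$$ On the unit disc $|\varphi|<1$, the solution space of $\mathscr{D}_{k,1}$ is $(k+2)$-dimensional and has a basis $\varpi^{k,1}_0,\dots,\varpi^{k,1}_{k+1}$ given by $$\varpi^{k,1}_i=\log^i\varphi,\qquad i=0,1,\dots,k-1,$$ $$\varpi^{k,1}_k=\log^k\varphi+\sum_{n=1}^\infty k!\,\frac{(-1)^n}{n^k}\,\varphi^n,$$ $$\varpi^{k,1}_{k+1}=\log^{k+1}\varphi+(k+1)\left(\sum_{n=1}^\infty k!\,\frac{(-1)^n}{n^k}\,\varphi^n\right)\log\varphi+\sum_{n=1}^\infty\frac{(k+1)!\,(-1)^n(-k+nH_{n,1})}{n^{k+1}}\,\varphi^n.$$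
   Context: $H_{n,1}=\sum_{m=1}^n\frac1m$. $\log^i\varphi$ means $(\log\varphi)^i$. The solutions are in general multivalued around the singular point $\varphi=0$; ''solution space on the unit disc'' means the complex vector space of (multivalued) holomorphic solutions $f$ of $\mathscr{D}_{k,1}f=0$ on $0<|\varphi|<1$, or equivalently single-valued holomorphic solutions on the slit disc $\{|\varphi|<1\}\setminus(-1,0]$ with $\log\varphi$ the principal branch. *)

(* Defs.v *)
From Stdlib Require Import Arith Reals Lra.
From Coquelicot Require Import Coquelicot.

Open Scope C_scope.

Definition slit_plane (z : C) : Prop := ~ (Im z = 0 /\ Re z <= 0)%R.

Definition slit_disc (z : C) : Prop := (Cmod z < 1)%R /\ slit_plane z.

Definition Cexp (z : C) : C := RtoC (exp (Re z)) * (cos (Im z), sin (Im z)).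

(* Principal logarithm.  The argument is given by the half-angle formula
   tan (arg z / 2) = Im z / (|z| + Re z), valid on the slit plane;
   [Clog_principal] below shows that this is the principal branch. *)
Definition Clog (z : C) : C :=
  (ln (Cmod z), (2 * atan (Im z / (Cmod z + Re z)))%R).

Lemma Clog_principal (z : C) :
  slit_plane z -> Cexp (Clog z) = z /\ (- PI < Im (Clog z) < PI)%R.
Proof.
destruct z as [x y]; unfold slit_plane, Cexp, Clog; simpl; intros Hz.
set (r := Cmod (x, y)).
assert (Hr0 : (0 <= r)%R) by apply Cmod_ge_0.
assert (Hr2 : (r * r = x * x + y * y)%R).
{ unfold r, Cmod; simpl; rewrite sqrt_sqrt; [ring | nra]. }
assert (Hrx : (0 < r + x)%R).
{ destruct (Req_dec y 0) as [Hy | Hy].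
  - assert (0 < x)%R by (apply Rnot_le_lt; intro; apply Hz; split; assumption).
    lra.
  - assert (0 < y * y)%R by nra.
    destruct (Rle_lt_dec (r + x) 0) as [Hn | Hp]; [exfalso; nra | exact Hp]. }
assert (Hr : (0 < r)%R) by nra.
set (t := (y / (r + x))%R).
assert (Hb := atan_bound t).
split; [ | split; lra].
assert (Hc : (0 < cos (atan t))%R) by (apply cos_gt_0; lra).
assert (Ht : (sin (atan t) = t * cos (atan t))%R).
{ rewrite <- (tan_atan t) at 2; unfold tan; field; lra. }
assert (Hs := sin2_cos2 (atan t)); unfold Rsqr in Hs; rewrite Ht in Hs.
assert (Hty : (t * (r + x) = y)%R) by (unfold t; field; lra).
assert (Htr : ((1 + t * t) * (r + x) = 2 * r)%R).
{ apply (Rmult_eq_reg_r (r + x)%R); [ | lra].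
  replace ((1 + t * t) * (r + x) * (r + x))%R
    with ((r + x) * (r + x) + (t * (r + x)) * (t * (r + x)))%R by ring.
  rewrite Hty; nra. }
assert (Hcc : (2 * r * (cos (atan t) * cos (atan t)) = r + x)%R).
{ rewrite <- Htr.
  replace ((1 + t * t) * (r + x) * (cos (atan t) * cos (atan t)))%R
    with ((r + x) * (t * cos (atan t) * (t * cos (atan t))
            + cos (atan t) * cos (atan t)))%R by ring.
  rewrite Hs; ring. }
rewrite (exp_ln r Hr), cos_2a_cos, sin_2a, Ht.
unfold Cmult, RtoC; simpl; apply injective_projections; simpl.
- lra.
- rewrite <- Hty.
  replace (t * (r + x))%R
    with (t * (2 * r * (cos (atan t) * cos (atan t))))%R by (now rewrite Hcc).
  ring.
Qed.

Definition holomorphic_on (D : C -> Prop) (f : C -> C) : Prop :=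
  forall z : C, D z -> ex_derive (K := C_AbsRing) (V := C_NormedModule) f z.

Definition theta (f : C -> C) (z : C) : C := z * C_derive f z.

Definition theta_iter (n : nat) (f : C -> C) : C -> C := Nat.iter n theta f.

Definition Dop (k : nat) (f : C -> C) (z : C) : C :=
  (1 + z) ^ 2 * theta_iter (k + 2) f z
  + 3 * z * (1 + z) * theta_iter (k + 1) f z
  + z * (1 + 2 * z) * theta_iter k f z.

(* [C_derive] is a total function with an unspecified value where the
   derivative does not exist; the holomorphy of theta^j f for j < k + 2
   (for j = 0 this is the holomorphy of f) makes every derivative in the
   equation a genuine one. *)
Definition holomorphic_solution (k : nat) (f : C -> C) : Prop :=
  (forall j : nat, (j < k + 2)%nat -> holomorphic_on slit_disc (theta_iter j f))
  /\ forall z : C, slit_disc z -> Dop k f z = 0.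

Fixpoint lincomb (d : nat) (c : nat -> C) (w : nat -> C -> C) (z : C) : C :=
  match d with
  | O => 0
  | S d' => lincomb d' c w z + c d' * w d' z
  end.

(* Functions on D are represented by total functions, of which only the values
   on D matter.  A family w_0, ..., w_(d-1) is a basis of the space V of
   functions on D when it is linearly independent and V is exactly its span
   (which contains each w_i). *)
Definition is_basis (D : C -> Prop) (V : (C -> C) -> Prop)
    (d : nat) (w : nat -> C -> C) : Prop :=
  (forall c : nat -> C,
     (forall z : C, D z -> lincomb d c w z = 0) ->
     forall i : nat, (i < d)%nat -> c i = 0)
  /\ (forall f : C -> C,
        V f <-> exists c : nat -> C, forall z : C, D z -> f z = lincomb d c w z).

Definition has_dimension (D : C -> Prop) (V : (C -> C) -> Prop) (d : nat) : Prop :=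
  exists w : nat -> C -> C, is_basis D V d w.

(* Sums are over n >= 1, hence the shift of the index. *)
Definition pseries_term (a : nat -> R) (z : C) (n : nat) : C :=
  RtoC (a (S n)) * z ^ S n.

Definition pseries_sum (a : nat -> R) (z : C) : C :=
  (Series (fun n => Re (pseries_term a z n)),
   Series (fun n => Im (pseries_term a z n))).

Definition harmonic (n : nat) : R := sum_n_m (fun m => / INR m)%R 1 n.

Definition coef0 (k n : nat) : R := (INR (fact k) * ((-1) ^ n / INR n ^ k))%R.

Definition coef1 (k n : nat) : R :=
  (INR (fact (k + 1)) * (-1) ^ n * (- INR k + INR n * harmonic n)
   / INR n ^ (k + 1))%R.

(* Meant for i <= k + 1; the last case is the one of i = k + 1. *)
Definition varpi (k i : nat) (z : C) : C :=
  if Nat.ltb i k then Clog z ^ i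
  else if Nat.eqb i k then Clog z ^ k + pseries_sum (coef0 k) z
  else Clog z ^ (k + 1)
       + RtoC (INR (k + 1)) * pseries_sum (coef0 k) z * Clog z
       + pseries_sum (coef1 k) z.

(* Main.v *)
(* The operator factors as
     D_{k,1} = theta o (1 + phi) o theta o (1 + phi) o theta^k .
   Its right factors T_0 = 1, T_1, ..., T_{k+2} = D_{k,1} satisfy
   T_{i+1} = m_i theta T_i with m_i = 1 or 1 + phi, which has no zero on the
   slit disc; so, the slit disc being star-shaped about 1/2, T_{i+1} f = 0 if
   and only if T_i f is constant.  Since T_i maps the i-th function of the
   family to the constant i!, subtracting multiples of the family one index at
   a time peels any solution down to 0, and the same constants give linear
   independence.  The value of T_{k+1} on the last function comes from
   (1 + z) sum (-1)^n H_n z^n = sum (-1)^n z^n / n. *)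

Require Import Defs.
From Stdlib Require Import Arith Reals Lra Lia.
From Coquelicot Require Import Coquelicot.

Open Scope C_scope.

(** * Complex derivatives on the slit disc *)

(** Total functions represent the mathematical ones only on the slit disc, and [theta_iter j f]
    nests [C_derive], so a formula for theta^j f can be differentiated only once it is known on a
    neighbourhood. Derivatives are therefore carried by the relation [Cderives], and a function f is
    described by a chain G_0 = f, G_1, ... with G_j' = G_{j+1} / z, which yields the holomorphy and
    the values of all theta^j f together. The chains of the explicit solutions rest on two analytic
    facts: the derivative of the principal logarithm, obtained from Cauchy-Riemann, and termwise
    differentiation of power series with polynomially growing coefficients. The shape of the last
    solution has this origin: the -k in its coefficients cancels the Leibniz term produced by the
    product with the logarithm, so that only (k+1)! (-1)^n H_n survives theta^k; multiplication by 1
    + z then gives T_k of it as (k+1)! log (z / (1+z)). *)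

Definition Cderives (f : C -> C) (z l : C) : Prop :=
  is_derive (K := C_AbsRing) (V := C_NormedModule) f z l.

Lemma Cderives_eps (f : C -> C) (z l : C) :
  Cderives f z l <->
  forall eps : posreal, exists d : posreal, forall w : C,
    (Cmod (w - z) < d)%R ->
    (Cmod (f w - f z - (w - z) * l) <= eps * Cmod (w - z))%R.
Proof.
split.
- intros [_ H] eps.
  destruct (H z (fun P HP => HP) eps) as [d Hd].
  exists d; intros w Hw; exact (Hd w Hw).
- intros H; split.
  + exact (is_linear_scal_l (K := C_AbsRing) (V := C_NormedModule) l).
  + intros x Hx eps.
    (* [filterdiff] asks for the estimate at every limit x of the filter; the limit is unique, so x
       is z. *)
    rewrite <- (is_filter_lim_locally_unique (K := C_AbsRing)
                  (V := AbsRing_NormedModule C_AbsRing) z x Hx).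
    destruct (H eps) as [d Hd].
    exists d; intros w Hw; exact (Hd w Hw).
Qed.

(* Coquelicot's product rule is about the normed module [AbsRing_NormedModule
   C_AbsRing], which has the same norm as [C_NormedModule] but is not
   convertible to it. *)
Lemma Cderives_AbsRing (f : C -> C) (z l : C) :
  is_derive (K := C_AbsRing) (V := AbsRing_NormedModule C_AbsRing) f z l <->
  Cderives f z l.
Proof.
split; intros [_ H]; (split; [apply is_linear_scal_l|]); exact H.
Qed.

Lemma Cderives_const (c z : C) : Cderives (fun _ => c) z 0.
Proof. exact (is_derive_const (K := C_AbsRing) (V := C_NormedModule) c z). Qed.

Lemma Cderives_id (z : C) : Cderives (fun w => w) z 1.
Proof. apply Cderives_AbsRing; exact (is_derive_id (K := C_AbsRing) z). Qed.

Lemma Cderives_plus (f g : C -> C) (z df dg : C) :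
  Cderives f z df -> Cderives g z dg ->
  Cderives (fun w => f w + g w) z (df + dg).
Proof. exact (is_derive_plus (K := C_AbsRing) (V := C_NormedModule) f g z df dg). Qed.

Lemma Cderives_mult (f g : C -> C) (z df dg : C) :
  Cderives f z df -> Cderives g z dg ->
  Cderives (fun w => f w * g w) z (df * g z + f z * dg).
Proof.
intros Hf Hg; apply Cderives_AbsRing in Hf, Hg; apply Cderives_AbsRing.
exact (is_derive_mult (K := C_AbsRing) f g z df dg Hf Hg Cmult_comm).
Qed.

Lemma Cderives_pow (f : C -> C) (n : nat) (z df : C) :
  Cderives f z df ->
  Cderives (fun w => f w ^ n) z (RtoC (INR n) * f z ^ (n - 1) * df).
Proof.
intros Hf; induction n as [|n IH].
- replace (RtoC (INR 0) * f z ^ (0 - 1) * df) with (RtoC 0) by (simpl; ring).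
  apply (Cderives_const 1).
- replace (RtoC (INR (S n)) * f z ^ (S n - 1) * df)
    with (df * f z ^ n + f z * (RtoC (INR n) * f z ^ (n - 1) * df)).
  + exact (Cderives_mult f (fun w => f w ^ n) z _ _ Hf IH).
  + rewrite S_INR, RtoC_plus; replace (S n - 1)%nat with n by lia.
    (* At n = 0 the truncated exponent n - 1 is 0, and the factor [INR 0] removes that term. *)
    destruct n as [|n]; [simpl; ring|].
    replace (S n - 1)%nat with n by lia.
    change (f z ^ S n) with (f z * f z ^ n); ring.
Qed.

Lemma Cderives_ext (D : C -> Prop) (f g : C -> C) (z l : C) :
  (exists d : posreal, forall w : C, (Cmod (w - z) < d)%R -> D w) ->
  (forall w, D w -> f w = g w) ->
  Cderives f z l -> Cderives g z l.
Proof.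
intros [d Hd] E H.
apply (is_derive_ext_loc (K := C_AbsRing) (V := C_NormedModule) f g z l); [|exact H].
exists d; intros w Hw; apply E, Hd, Hw.
Qed.

Lemma Cderives_unique (f : C -> C) (z l l' : C) :
  Cderives f z l -> Cderives f z l' -> l = l'.
Proof.
intros H H'.
rewrite <- (is_C_derive_unique f z l H); exact (is_C_derive_unique f z l' H').
Qed.

(** * Geometry of the slit disc, and functions with zero derivative on it *)

Lemma slit_plane_pos (z : C) : slit_plane z <-> (0 < Cmod z + Re z)%R.
Proof.
destruct z as [x y]; unfold slit_plane; simpl.
assert (Hr0 : (0 <= Cmod (x, y))%R) by apply Cmod_ge_0.
assert (Hr2 : (Cmod (x, y) * Cmod (x, y) = x * x + y * y)%R).
{ unfold Cmod; simpl; rewrite sqrt_sqrt; [ring | nra]. }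
split.
- intros Hz; destruct (Req_dec y 0) as [Hy | Hy].
  + assert (0 < x)%R by (apply Rnot_le_lt; intro; apply Hz; split; assumption).
    lra.
  + assert (0 < y * y)%R by nra.
    destruct (Rle_lt_dec (Cmod (x, y) + x) 0) as [Hn | Hp]; [exfalso; nra | exact Hp].
- intros Hp [-> Hx]; nra.
Qed.

Lemma Cmod_minus_abs (z w : C) : (Rabs (Cmod w - Cmod z) <= Cmod (w - z))%R.
Proof.
assert (H1 := Cmod_triangle (w - z) z).
assert (H2 := Cmod_triangle (z - w) w).
replace (w - z + z) with w in H1 by ring.
replace (z - w + w) with z in H2 by ring.
replace (z - w) with (- (w - z)) in H2 by ring.
rewrite Cmod_opp in H2; apply Rabs_le; lra.
Qed.

(** Both conditions are strict inequalities, |z| < 1 and |z| + Re z > 0. A displacement less than d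
    changes |z| and Re z by less than d each, whence the half in the second bound on the radius. *)
Lemma slit_disc_open (z : C) : slit_disc z ->
  exists d : posreal, forall w : C, (Cmod (w - z) < d)%R -> slit_disc w.
Proof.
intros [H1 H2]; apply slit_plane_pos in H2.
assert (Hd : (0 < Rmin (1 - Cmod z) ((Cmod z + Re z) / 2))%R).
{ apply Rmin_glb_lt; lra. }
exists (mkposreal _ Hd); simpl; intros w Hw.
assert (Ha := Rmin_l (1 - Cmod z) ((Cmod z + Re z) / 2)).
assert (Hb := Rmin_r (1 - Cmod z) ((Cmod z + Re z) / 2)).
assert (Hc := Cmod_minus_abs z w); apply Rabs_le_between in Hc.
assert (Hr := re_le_Cmod (w - z)); apply Rabs_le_between in Hr.
split; [lra|].
apply slit_plane_pos.
assert (Re (w - z) = (Re w - Re z)%R) by reflexivity.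
lra.
Qed.

Lemma slit_disc_nonzero (z : C) : slit_disc z -> z <> 0.
Proof. intros [_ H] ->; apply H; simpl; lra. Qed.

Lemma Cplus_1_nonzero (z : C) : (Cmod z < 1)%R -> 1 + z <> 0.
Proof.
intros H E.
assert (z = - (1)) as -> by (replace z with (1 + z - 1) by ring; rewrite E; ring).
rewrite Cmod_m1 in H; lra.
Qed.

Lemma slit_disc_half : slit_disc (RtoC (/ 2)).
Proof.
split; [rewrite Cmod_R, Rabs_pos_eq; lra | unfold slit_plane; simpl; lra].
Qed.

Lemma slit_disc_segment (z : C) (t : R) : slit_disc z -> (0 <= t <= 1)%R ->
  slit_disc (RtoC (/ 2) + RtoC t * (z - RtoC (/ 2))).
Proof.
intros [H1 H2] Ht; split.
- replace (RtoC (/ 2) + RtoC t * (z - RtoC (/ 2)))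
    with (RtoC ((1 - t) / 2) + RtoC t * z)
    by (unfold Rdiv; rewrite RtoC_mult, RtoC_minus; ring).
  eapply Rle_lt_trans; [apply Cmod_triangle|].
  rewrite Cmod_mult, !Cmod_R, !Rabs_pos_eq by lra.
  assert (H0 := Cmod_ge_0 z); nra.
- destruct z as [x y]; unfold slit_plane in *; simpl in *.
  intros [E1 E2]; apply H2.
  destruct (Req_dec t 0) as [->|Ht0]; [lra|].
  assert (t * y = 0)%R as Ey by lra.
  apply Rmult_integral in Ey; destruct Ey as [Ey|Ey]; [lra|].
  split; [exact Ey|]; nra.
Qed.

(** Reduces to real functions on a segment, where the mean value theorem applies; [pr] stands for
    [Re] or [Im]. The radius is rescaled by 1 + |v| instead of |v| so that v = 0 is covered. *)
Lemma real_derive_zero (f : C -> C) (p v : C) (t : R) (pr : C -> R) :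
  (forall a b, pr (a - b) = (pr a - pr b)%R) ->
  (forall a, (Rabs (pr a) <= Cmod a)%R) ->
  Cderives f (p + RtoC t * v) 0 ->
  is_derive (fun s : R => pr (f (p + RtoC s * v))) t 0%R.
Proof.
intros Hm Hb H.
split; [apply is_linear_scal_l|].
intros x Hx.
rewrite <- (is_filter_lim_locally_unique (K := R_AbsRing)
              (V := AbsRing_NormedModule R_AbsRing) t x Hx).
intros eps.
assert (Hv : (0 < 1 + Cmod v)%R) by (assert (H0 := Cmod_ge_0 v); lra).
assert (He : (0 < eps / (1 + Cmod v))%R) by (apply Rdiv_lt_0_compat; [apply cond_pos|lra]).
destruct (proj1 (Cderives_eps _ _ _) H (mkposreal _ He)) as [d Hd].
assert (Hd' : (0 < d / (1 + Cmod v))%R) by (apply Rdiv_lt_0_compat; [apply cond_pos|lra]).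
exists (mkposreal _ Hd'); intros s Hs.
change (Rabs (s - t) < d / (1 + Cmod v))%R in Hs.
change (Rabs (pr (f (p + RtoC s * v)%C) - pr (f (p + RtoC t * v)%C) - (s - t) * 0)
        <= eps * Rabs (s - t))%R.
assert (E : Cmod (p + RtoC s * v - (p + RtoC t * v)) = (Rabs (s - t) * Cmod v)%R).
{ replace (p + RtoC s * v - (p + RtoC t * v)) with (RtoC (s - t) * v)
    by (rewrite RtoC_minus; ring).
  now rewrite Cmod_mult, Cmod_R. }
assert (H0 := Cmod_ge_0 v). assert (H1 := Rabs_pos (s - t)).
specialize (Hd (p + RtoC s * v)%C); rewrite E in Hd.
rewrite Rmult_0_r, Rminus_0_r, <- Hm.
replace (f (p + RtoC s * v) - f (p + RtoC t * v) - (p + RtoC s * v - (p + RtoC t * v)) * 0)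
  with (f (p + RtoC s * v) - f (p + RtoC t * v)) in Hd by ring.
eapply Rle_trans; [apply Hb|].
eapply Rle_trans; [apply Hd|].
- apply Rle_lt_trans with (Rabs (s - t) * (1 + Cmod v))%R; [nra|].
  apply (Rmult_lt_compat_r (1 + Cmod v)) in Hs; [|lra].
  replace (d / (1 + Cmod v) * (1 + Cmod v))%R with (pos d) in Hs by (field; lra).
  exact Hs.
- simpl.
  replace (eps * Rabs (s - t))%R
    with (eps / (1 + Cmod v) * (Rabs (s - t) * (1 + Cmod v)))%R by (field; lra).
  apply Rmult_le_compat_l; [lra|nra].
Qed.

Lemma constant_on_slit_disc (f : C -> C) :
  (forall z, slit_disc z -> Cderives f z 0) ->
  forall z, slit_disc z -> f z = f (RtoC (/ 2)).
Proof.
intros H z Hz.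
assert (E : forall pr : C -> R,
  (forall a b, pr (a - b) = (pr a - pr b)%R) ->
  (forall a, (Rabs (pr a) <= Cmod a)%R) -> pr (f z) = pr (f (RtoC (/ 2)))).
{ intros pr Hm Hb.
  assert (G := eq_is_derive
    (fun s : R => pr (f (RtoC (/ 2) + RtoC s * (z - RtoC (/ 2))))) 0 1).
  simpl in G.
  replace (RtoC (/ 2) + RtoC 1 * (z - RtoC (/ 2))) with z in G by ring.
  replace (RtoC (/ 2) + RtoC 0 * (z - RtoC (/ 2))) with (RtoC (/ 2)) in G by ring.
  symmetry; apply G; [|lra].
  intros t Ht; apply (real_derive_zero f _ _ t pr Hm Hb).
  apply H, slit_disc_segment; assumption. }
apply injective_projections; apply E; try reflexivity.
- exact re_le_Cmod.
- intros a; assert (Ha := Rmax_Cmod a).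
  eapply Rle_trans; [apply Rmax_r|exact Ha].
Qed.

(** * The derivative of the logarithm *)

Lemma Cmod_le_abs (z : C) : (Cmod z <= Rabs (Re z) + Rabs (Im z))%R.
Proof.
replace z with (RtoC (Re z) + Ci * RtoC (Im z)) at 1.
- eapply Rle_trans; [apply Cmod_triangle|].
  rewrite Cmod_mult, Cmod_Ci, !Cmod_R; lra.
- destruct z as [x y]; apply injective_projections; simpl; ring.
Qed.

Lemma im_le_Cmod (z : C) : (Rabs (Im z) <= Cmod z)%R.
Proof. eapply Rle_trans; [apply Rmax_r|exact (Rmax_Cmod z)]. Qed.

Definition R2 := prod_NormedModule R_AbsRing R_NormedModule R_NormedModule.

(** Real differentiability in the plane, with p and q the two partial derivatives. *)
Definition differentiable (u : R * R -> R) (z : R * R) (p q : R) : Prop :=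
  filterdiff (K := R_AbsRing) (U := R2) (V := R_NormedModule)
    u (locally (T := R2) z) (fun h => p * fst h + q * snd h)%R.

Lemma differentiable_eps (u : R * R -> R) (z : C) (p q : R) :
  differentiable u z p q ->
  forall eps : posreal, exists d : posreal, forall w : C,
    (Cmod (w - z)%C < d)%R ->
    (Rabs (u w - u z - (p * (Re w - Re z) + q * (Im w - Im z)))
       <= eps * Cmod (w - z)%C)%R.
Proof.
intros [_ H] eps.
destruct (H z (fun P HP => HP) eps) as [d Hd].
exists d; intros w Hw.
(* The norm of [R2] is Euclidean, hence equal to [Cmod], but its balls are products of intervals, so
   membership in them is checked on each coordinate. *)
assert (E : norm (minus (G := R2) w z) = Cmod (w - z)).
{ transitivity (sqrt (Rabs (fst w - fst z) ^ 2 + Rabs (snd w - snd z) ^ 2)).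
  - reflexivity.
  - rewrite !pow2_abs; reflexivity. }
rewrite <- E; apply (Hd w).
split.
- eapply Rle_lt_trans; [apply (re_le_Cmod (w - z))|exact Hw].
- eapply Rle_lt_trans; [apply (im_le_Cmod (w - z))|exact Hw].
Qed.

(** The real matrix with rows (p, -q) and (q, p) is multiplication by p + i q, so the two real
    errors are the parts of the complex one, and each receives half of eps. *)
Lemma Cauchy_Riemann (u v : R * R -> R) (z : C) (p q : R) :
  differentiable u z p (- q) -> differentiable v z q p ->
  Cderives (fun w => (u w, v w)) z (p, q).
Proof.
intros Hu Hv; apply Cderives_eps; intros eps.
assert (He : (0 < eps / 2)%R) by (assert (H := cond_pos eps); lra).
destruct (differentiable_eps u z p (- q) Hu (mkposreal _ He)) as [d1 H1].
destruct (differentiable_eps v z q p Hv (mkposreal _ He)) as [d2 H2].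
assert (Hd : (0 < Rmin d1 d2)%R) by (apply Rmin_glb_lt; apply cond_pos).
exists (mkposreal _ Hd); simpl; intros w Hw.
specialize (H1 w (Rlt_le_trans _ _ _ Hw (Rmin_l _ _))).
specialize (H2 w (Rlt_le_trans _ _ _ Hw (Rmin_r _ _))).
simpl in H1, H2.
eapply Rle_trans; [apply Cmod_le_abs|].
replace (Re ((u w, v w) - (u z, v z) - (w - z) * (p, q)))
  with (u w - u z - (p * (Re w - Re z) + - q * (Im w - Im z)))%R
  by (simpl; unfold Re, Im; ring).
replace (Im ((u w, v w) - (u z, v z) - (w - z) * (p, q)))
  with (v w - v z - (q * (Re w - Re z) + p * (Im w - Im z)))%R
  by (simpl; unfold Re, Im; ring).
lra.
Qed.

Lemma differentiable_fst (z : R * R) : differentiable fst z 1 0.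
Proof.
apply (filterdiff_ext_lin (K := R_AbsRing) (U := R2) (V := R_NormedModule)
         fst fst).
- apply filterdiff_linear; apply is_linear_fst.
- intros h; simpl; ring.
Qed.

Lemma differentiable_snd (z : R * R) : differentiable snd z 0 1.
Proof.
apply (filterdiff_ext_lin (K := R_AbsRing) (U := R2) (V := R_NormedModule)
         snd snd).
- apply filterdiff_linear; apply is_linear_snd.
- intros h; simpl; ring.
Qed.

Lemma differentiable_comp (u : R * R -> R) (g : R -> R) (z : R * R) (p q l : R) :
  differentiable u z p q -> is_derive g (u z) l ->
  differentiable (fun w => g (u w)) z (l * p) (l * q).
Proof.
intros Hu Hg.
apply (filterdiff_ext_lin (K := R_AbsRing) (U := R2) (V := R_NormedModule)
         (fun w => g (u w)) (fun h : R * R => scal (p * fst h + q * snd h)%R l)).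
- exact (filterdiff_comp' (K := R_AbsRing) (U := R2) (V := R_NormedModule)
           (W := R_NormedModule) u g z _ (fun y => scal y l) Hu Hg).
- intros h; unfold scal; simpl; unfold mult; simpl; ring.
Qed.

Lemma differentiable_plus (u v : R * R -> R) (z : R * R) (p q p' q' : R) :
  differentiable u z p q -> differentiable v z p' q' ->
  differentiable (fun w => u w + v w)%R z (p + p') (q + q').
Proof.
intros Hu Hv.
apply (filterdiff_ext_lin (K := R_AbsRing) (U := R2) (V := R_NormedModule)
         (fun w => u w + v w)%R
         (fun h : R * R => plus (p * fst h + q * snd h)%R (p' * fst h + q' * snd h)%R)).
- exact (filterdiff_plus_fct u v _ _ Hu Hv).
- intros h; unfold plus; simpl; ring.
Qed.

Lemma differentiable_mult (u v : R * R -> R) (z : R * R) (p q p' q' : R) :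
  differentiable u z p q -> differentiable v z p' q' ->
  differentiable (fun w => u w * v w)%R z
    (p * v z + u z * p') (q * v z + u z * q').
Proof.
intros Hu Hv.
apply (filterdiff_ext_lin (K := R_AbsRing) (U := R2) (V := R_NormedModule)
         (fun w => u w * v w)%R
         (fun h : R * R => plus (mult (p * fst h + q * snd h)%R (v z))
                          (mult (u z) (p' * fst h + q' * snd h)%R))).
- exact (filterdiff_mult_fct (U := R2) u v z _ _ Rmult_comm Hu Hv).
- intros h; unfold plus, mult; simpl; ring.
Qed.

Lemma differentiable_eq (u : R * R -> R) (z : R * R) (p q p' q' : R) :
  differentiable u z p q -> p = p' -> q = q' -> differentiable u z p' q'.
Proof. intros H <- <-; exact H. Qed.

(** With r = |z|, the two components have gradients (x, y) / r^2 and (-y, x) / r^2, which belong to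
    the complex derivative (x - i y) / r^2 = 1 / z. On the slit plane r + x > 0, so the half-angle
    quotient is differentiable. *)
Lemma Cderives_Clog (z : C) : slit_plane z -> Cderives Clog z (/ z).
Proof.
intros Hz; apply slit_plane_pos in Hz.
destruct z as [x y].
assert (Hr2 : (Cmod (x, y) * Cmod (x, y) = x * x + y * y)%R).
{ unfold Cmod; simpl; rewrite sqrt_sqrt; [ring | nra]. }
assert (Hr0 : (0 <= Cmod (x, y))%R) by apply Cmod_ge_0.
simpl in Hz.
assert (Hr : (0 < Cmod (x, y))%R) by nra.
assert (Hs : (0 < x * x + y * y)%R) by nra.
assert (Hmod : differentiable Cmod (x, y)
                 (x / Cmod (x, y)) (y / Cmod (x, y))).
{ set (s := fun w : R * R => (fst w * fst w + snd w * snd w)%R).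
  apply (filterdiff_ext (K := R_AbsRing) (U := R2) (V := R_NormedModule)
           (fun w => sqrt (s w))).
  { intros w; unfold Cmod, s; f_equal; simpl; ring. }
  assert (Hsd : differentiable s (x, y) (1 * x + x * 1 + (0 * y + y * 0))
                  (0 * x + x * 0 + (1 * y + y * 1))).
  { apply (differentiable_plus (fun w => (fst w * fst w)%R) (fun w => (snd w * snd w)%R)).
    - exact (differentiable_mult fst fst (x, y) _ _ _ _
               (differentiable_fst (x, y)) (differentiable_fst (x, y))).
    - exact (differentiable_mult snd snd (x, y) _ _ _ _
               (differentiable_snd (x, y)) (differentiable_snd (x, y))). }
  assert (Hsq : is_derive sqrt (s (x, y)) (/ (2 * Cmod (x, y)))%R).
  { replace (Cmod (x, y)) with (sqrt (s (x, y)))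
      by (unfold Cmod, s; f_equal; simpl; ring).
    apply is_derive_Reals, derivable_pt_lim_sqrt; exact Hs. }
  apply (differentiable_eq _ _ _ _ _ _ (differentiable_comp s sqrt _ _ _ _ Hsd Hsq));
    field; lra. }
replace (/ (x, y))
  with ((/ Cmod (x, y) * (x / Cmod (x, y)))%R, (- (y / (Cmod (x, y) * Cmod (x, y))))%R).
2: { unfold Cinv; simpl; apply injective_projections; simpl.
     - replace (x * (x * 1) + y * (y * 1))%R with (Cmod (x, y) * Cmod (x, y))%R
         by lra; field; lra.
     - replace (x * (x * 1) + y * (y * 1))%R with (Cmod (x, y) * Cmod (x, y))%R
         by lra; field; lra. }
apply (Cauchy_Riemann (fun w => ln (Cmod w))
         (fun w => (2 * atan (Im w / (Cmod w + Re w)))%R)).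
- assert (Hln : is_derive ln (Cmod (x, y)) (/ Cmod (x, y))%R).
  { apply is_derive_Reals, derivable_pt_lim_ln; exact Hr. }
  apply (differentiable_eq _ _ _ _ _ _ (differentiable_comp Cmod ln _ _ _ _ Hmod Hln));
    field; lra.
- set (r := Cmod (x, y)) in *.
  assert (Hden := differentiable_plus Cmod fst (x, y) _ _ _ _ Hmod
                    (differentiable_fst (x, y))).
  assert (Hinv : is_derive Rinv (Cmod (x, y) + fst (x, y))%R (- / ((r + x) * (r + x)))%R).
  { replace (- / ((r + x) * (r + x)))%R with (- (1) / (Cmod (x, y) + fst (x, y)) ^ 2)%R
      by (fold r; simpl; field; lra).
    apply (is_derive_inv (fun t => t) _ 1%R);
      [exact (is_derive_id (K := R_AbsRing) _) | fold r; simpl; lra]. }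
  assert (Hquo := differentiable_mult snd _ (x, y) _ _ _ _
           (differentiable_snd (x, y))
           (differentiable_comp (fun w => (Cmod w + fst w)%R) Rinv _ _ _ _ Hden Hinv)).
  assert (Hat : is_derive (fun t => (2 * atan t)%R) (y / (r + x))%R
                  (2 * / (1 + (y / (r + x)) ^ 2))%R).
  { apply is_derive_scal; apply is_derive_Reals.
    exact (derivable_pt_lim_atan (y / (r + x))). }
  apply (differentiable_eq _ _ _ _ _ _
           (differentiable_comp _ (fun t => (2 * atan t)%R) _ _ _ _ Hquo Hat)).
  + fold r; simpl.
    assert (0 < (r + x) * (r + x) + y * y)%R by nra.
    field_simplify_eq; [|repeat split; try lra; nra].
    (* The identity holds only modulo r^2 = x^2 + y^2; eliminating y^2 leaves one that [ring]
       decides. *)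
    replace (y ^ 3)%R with (y * (r * r - x * x))%R by (rewrite Hr2; ring).
    replace (y ^ 2)%R with (r * r - x * x)%R by (rewrite Hr2; ring).
    ring.
  + fold r; simpl.
    assert (0 < (r + x) * (r + x) + y * y)%R by nra.
    field_simplify_eq; [|repeat split; try lra; nra].
    replace (y ^ 3)%R with (y * (r * r - x * x))%R by (rewrite Hr2; ring).
    replace (y ^ 2)%R with (r * r - x * x)%R by (rewrite Hr2; ring).
    ring.
Qed.

(** * Complex power series with real coefficients *)

Definition Cis_series (a : nat -> C) (l : C) : Prop :=
  is_series (K := C_AbsRing) (V := C_NormedModule) a l.

Lemma sum_n_Re_Im (a : nat -> C) (n : nat) :
  sum_n (G := C_AbelianGroup) a n
  = (sum_n (fun m => Re (a m)) n, sum_n (fun m => Im (a m)) n).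
Proof.
induction n as [|n IH].
- rewrite !sum_O; now destruct (a 0%nat).
- rewrite !sum_Sn, IH; reflexivity.
Qed.

(** Links convergence in C, where limits and norms are handled, with the componentwise [Series] that
    define [pseries_sum]. *)
Lemma Cis_series_Re_Im (a : nat -> C) (l : C) :
  Cis_series a l <->
  is_series (fun n => Re (a n)) (Re l) /\ is_series (fun n => Im (a n)) (Im l).
Proof.
unfold Cis_series, is_series; split.
- intros H; split; intros P [eps HP].
  + assert (G : locally (T := C_UniformSpace) l (fun w => P (Re w))).
    { exists eps; intros w [Hw _]; exact (HP _ Hw). }
    refine (filter_imp (F := eventually) _ _ _ (H _ G)); intros n.
    rewrite sum_n_Re_Im; exact (fun X => X).
  + assert (G : locally (T := C_UniformSpace) l (fun w => P (Im w))).
    { exists eps; intros w [_ Hw]; exact (HP _ Hw). }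
    refine (filter_imp (F := eventually) _ _ _ (H _ G)); intros n.
    rewrite sum_n_Re_Im; exact (fun X => X).
- intros [H1 H2] P [eps HP].
  refine (filter_imp (F := eventually) _ _ _
            (filter_and (F := eventually) _ _ (H1 _ (locally_ball (Re l) eps))
               (H2 _ (locally_ball (Im l) eps)))); intros n [G1 G2].
  apply HP; rewrite sum_n_Re_Im; split; assumption.
Qed.

Lemma Cis_series_plus (a b : nat -> C) (l l' : C) :
  Cis_series a l -> Cis_series b l' -> Cis_series (fun n => a n + b n) (l + l').
Proof. exact (is_series_plus (K := C_AbsRing) (V := C_NormedModule) a b l l'). Qed.

Lemma Cis_series_scal (c : C) (a : nat -> C) (l : C) :
  Cis_series a l -> Cis_series (fun n => c * a n) (c * l).
Proof. exact (is_series_scal (K := C_AbsRing) (V := C_NormedModule) c a l). Qed.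

Lemma Cis_series_ext (a b : nat -> C) (l : C) :
  (forall n, a n = b n) -> Cis_series a l -> Cis_series b l.
Proof. exact (is_series_ext (K := C_AbsRing) (V := C_NormedModule) a b l). Qed.

Lemma Cis_series_decr_1 (a : nat -> C) (l : C) :
  Cis_series (fun n => a (S n)) l -> Cis_series a (l + a 0%nat).
Proof.
intros H; apply (is_series_decr_1 (K := C_AbsRing) (V := C_NormedModule)).
change (Cis_series (fun n => a (S n)) (l + a 0%nat + - a 0%nat)).
now replace (l + a 0%nat + - a 0%nat) with l by ring.
Qed.

Lemma Cis_series_bound (a : nat -> C) (b : nat -> R) (l : C) (B : R) :
  Cis_series a l -> is_series b B -> (forall n, (Cmod (a n) <= b n)%R) ->
  (Cmod l <= B)%R.
Proof.
intros Ha Hb Hab.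
apply (filterlim_le (F := eventually) (fun n => norm (V := C_NormedModule) (sum_n a n)) (sum_n b)
         (Finite (Cmod l)) (Finite B)).
- exists 0%nat; intros n _.
  eapply Rle_trans; [apply (norm_sum_n_m (V := C_NormedModule))|].
  apply sum_n_m_le; exact Hab.
- apply (filterlim_comp _ _ _ _ _ _ _ _ Ha).
  exact (filterlim_norm (V := C_NormedModule) l).
- exact Hb.
Qed.

(** Polynomial growth gives absolute convergence on the open disc and, unlike boundedness, is stable
    under multiplying the n-th coefficient by n, which is the action of theta. It constrains the
    indices n >= 1, those of [pseries_sum]. *)
Definition tempered (a : nat -> R) : Prop :=
  exists (M : R) (p : nat), forall n, (Rabs (a (S n)) <= M * INR (S n) ^ p)%R.

(** The series with coefficients n^(p+1) is x d/dx of the one with coefficients n^p, and neither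
    differentiation nor multiplication by x changes the radius. *)
Lemma CV_radius_pow (p : nat) : Rbar_le 1 (CV_radius (fun n => INR n ^ p)%R).
Proof.
induction p as [|p IH].
- apply CV_radius_bounded; exists 1%R; intros n.
  simpl; rewrite pow1, Rmult_1_r, Rabs_R1; lra.
- erewrite CV_radius_ext.
  + rewrite CV_radius_incr_1; rewrite CV_radius_derive; exact IH.
  + intros [|n]; [exact (Rmult_0_l _)|reflexivity].
Qed.

Lemma ex_series_tempered (a : nat -> R) (r : R) :
  tempered a -> (0 <= r < 1)%R ->
  ex_series (fun n => Rabs (a (S n)) * r ^ S n)%R.
Proof.
intros [M [p Ha]] Hr.
apply (ex_series_le (K := R_AbsRing) (V := R_CompleteNormedModule)
         _ (fun n => M * Rabs (INR (S n) ^ p * r ^ S n))%R).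
- intros n; change (Rabs (Rabs (a (S n)) * r ^ S n)
                    <= M * Rabs (INR (S n) ^ p * r ^ S n))%R.
  assert (Hp : (0 <= r ^ S n)%R) by (apply pow_le; lra).
  assert (Hi : (0 <= INR (S n) ^ p)%R) by (apply pow_le, pos_INR).
  rewrite !Rabs_mult, Rabs_Rabsolu, (Rabs_pos_eq _ Hp), (Rabs_pos_eq _ Hi).
  rewrite <- Rmult_assoc; apply Rmult_le_compat_r; [exact Hp|apply Ha].
- apply (ex_series_scal (K := R_AbsRing) (V := R_NormedModule)
           M (fun n => Rabs (INR (S n) ^ p * r ^ S n))%R).
  apply (ex_series_incr_1 (K := R_AbsRing) (V := R_NormedModule)
           (fun n => Rabs (INR n ^ p * r ^ n))%R).
  apply (CV_disk_inside (fun n => INR n ^ p)%R).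
  eapply Rbar_lt_le_trans; [|apply CV_radius_pow].
  simpl; rewrite Rabs_pos_eq; lra.
Qed.

Lemma tempered_pow_mult (j : nat) (a : nat -> R) :
  tempered a -> tempered (fun n => INR n ^ j * a n)%R.
Proof.
intros [M [p Ha]]; exists M, (j + p)%nat; intros n.
assert (Hi : (0 <= INR (S n) ^ j)%R) by (apply pow_le, pos_INR).
rewrite Rabs_mult, (Rabs_pos_eq _ Hi), pow_add.
replace (M * (INR (S n) ^ j * INR (S n) ^ p))%R
  with (INR (S n) ^ j * (M * INR (S n) ^ p))%R by ring.
apply Rmult_le_compat_l; [exact Hi|apply Ha].
Qed.

Lemma Cmod_pseries_term (a : nat -> R) (z : C) (n : nat) :
  Cmod (pseries_term a z n) = (Rabs (a (S n)) * Cmod z ^ S n)%R.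
Proof. unfold pseries_term; now rewrite Cmod_mult, Cmod_R, Cmod_pow. Qed.

Lemma pseries_sum_correct (a : nat -> R) (z : C) :
  tempered a -> (Cmod z < 1)%R -> Cis_series (pseries_term a z) (pseries_sum a z).
Proof.
intros Ha Hz.
assert (He := ex_series_tempered a (Cmod z) Ha (conj (Cmod_ge_0 z) Hz)).
apply Cis_series_Re_Im; split; apply Series_correct;
  apply (ex_series_le (K := R_AbsRing) (V := R_CompleteNormedModule)
           _ _) with (2 := He); intros n; rewrite <- Cmod_pseries_term.
- apply re_le_Cmod.
- apply im_le_Cmod.
Qed.

Lemma pseries_sum_unique (a : nat -> R) (z l : C) :
  Cis_series (pseries_term a z) l -> pseries_sum a z = l.
Proof.
intros H; apply Cis_series_Re_Im in H; destruct H as [H1 H2].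
unfold pseries_sum; rewrite (is_series_unique _ _ H1), (is_series_unique _ _ H2).
now destruct l.
Qed.

Lemma pseries_sum_ext (a b : nat -> R) (z : C) :
  (forall n, a (S n) = b (S n)) -> pseries_sum a z = pseries_sum b z.
Proof.
intros E; unfold pseries_sum; f_equal; apply Series_ext; intros n;
  unfold pseries_term; now rewrite E.
Qed.

Lemma pseries_sum_lin (a b : nat -> R) (s t : R) (z : C) :
  tempered a -> tempered b -> (Cmod z < 1)%R ->
  pseries_sum (fun n => s * a n + t * b n)%R z
  = RtoC s * pseries_sum a z + RtoC t * pseries_sum b z.
Proof.
intros Ha Hb Hz; apply pseries_sum_unique.
eapply Cis_series_ext;
  [|apply Cis_series_plus; apply Cis_series_scal, pseries_sum_correct; assumption].
intros n; unfold pseries_term; rewrite RtoC_plus, !RtoC_mult; ring.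
Qed.

Lemma pseries_sum_1_plus (a b : nat -> R) (z : C) :
  tempered a -> (Cmod z < 1)%R ->
  b 1%nat = a 1%nat -> (forall n, b (S (S n)) = a (S (S n)) + a (S n))%R ->
  (1 + z) * pseries_sum a z = pseries_sum b z.
Proof.
intros Ha Hz E1 E2; symmetry; apply pseries_sum_unique.
assert (H := pseries_sum_correct a z Ha Hz).
(* The series multiplied by z, delayed by one place so that its n-th term has the same power of z as
   the n-th term of the original series. *)
set (s := fun n => match n with O => RtoC 0 | S m => z * pseries_term a z m end).
assert (Hs : Cis_series s (z * pseries_sum a z)).
{ replace (z * pseries_sum a z) with (z * pseries_sum a z + s 0%nat)
    by (unfold s; ring).
  apply Cis_series_decr_1; simpl; now apply Cis_series_scal. }
replace ((1 + z) * pseries_sum a z)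
  with (pseries_sum a z + z * pseries_sum a z) by ring.
eapply Cis_series_ext; [|exact (Cis_series_plus _ _ _ _ H Hs)].
intros [|n]; unfold s, pseries_term.
- rewrite E1; ring.
- rewrite E2, RtoC_plus; change (z ^ S (S n)) with (z * z ^ S n); ring.
Qed.

Lemma pseries_sum_linear_term (a : nat -> R) (z : C) :
  (forall n, a (S (S n)) = 0%R) -> pseries_sum a z = RtoC (a 1%nat) * z.
Proof.
intros E; apply pseries_sum_unique.
replace (RtoC (a 1%nat) * z) with (0 + pseries_term a z 0)
  by (unfold pseries_term; simpl; ring).
apply Cis_series_decr_1.
apply (Cis_series_ext (fun _ => RtoC 0)).
- intros n; unfold pseries_term; rewrite E; ring.
- apply (filterlim_ext (fun _ : nat => RtoC 0)); [|apply filterlim_const].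
  intros n; symmetry; apply (sum_n_m_const_zero (G := C_AbelianGroup)).
Qed.

(* The second-order remainder of [w ^ n] at [z], multiplied by [z * r] to avoid
   the exponents [n - 1] and [n - 2]. *)
Lemma pow_taylor_bound (z w : C) (r : R) (n : nat) :
  (0 < r)%R -> (Cmod z <= r)%R -> (Cmod w <= r)%R ->
  (Cmod (z * (w ^ n - z ^ n) - (w - z) * (RtoC (INR n) * z ^ n)) * r
   <= INR n ^ 2 * r ^ n * Cmod (w - z) ^ 2)%R.
Proof.
intros Hr Hz Hw; induction n as [|n IH].
- replace (z * (w ^ 0 - z ^ 0) - (w - z) * (RtoC (INR 0) * z ^ 0)) with (RtoC 0)
    by (simpl; ring).
  rewrite Cmod_0; simpl; lra.
- set (e := z * (w ^ n - z ^ n) - (w - z) * (RtoC (INR n) * z ^ n)) in *.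
  replace (z * (w ^ S n - z ^ S n) - (w - z) * (RtoC (INR (S n)) * z ^ S n))
    (* The remainder satisfies e_{n+1} = w e_n + n z^n (w - z)^2, which drives the induction. *)
    with (w * e + RtoC (INR n) * z ^ n * (w - z) ^ 2).
  2: { unfold e; rewrite S_INR, RtoC_plus.
       change (w ^ S n) with (w * w ^ n); change (z ^ S n) with (z * z ^ n).
       simpl; ring. }
  assert (Hn := pos_INR n).
  assert (Hrn : (0 <= r ^ n)%R) by (apply pow_le; lra).
  assert (Hzn : (Cmod z ^ n <= r ^ n)%R)
    by (apply pow_incr; split; [apply Cmod_ge_0|exact Hz]).
  assert (Hq : (0 <= Cmod (w - z) ^ 2)%R) by apply pow2_ge_0.
  assert (He := Cmod_ge_0 e).
  assert (H1 : (Cmod (w * e) * r <= r * (INR n ^ 2 * r ^ n * Cmod (w - z) ^ 2))%R).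
  { rewrite Cmod_mult, Rmult_assoc.
    apply Rmult_le_compat; [apply Cmod_ge_0|nra|exact Hw|exact IH]. }
  assert (H2 : (Cmod (RtoC (INR n) * z ^ n * (w - z) ^ 2) * r
                <= INR n * r ^ n * Cmod (w - z) ^ 2 * r)%R).
  { rewrite !Cmod_mult, Cmod_R, !Cmod_pow, (Rabs_pos_eq _ Hn).
    apply Rmult_le_compat_r; [lra|]; apply Rmult_le_compat_r; [exact Hq|].
    apply Rmult_le_compat_l; assumption. }
  assert (H3 : (0 <= r * (r ^ n * Cmod (w - z) ^ 2))%R)
    by (apply Rmult_le_pos; [lra|]; apply Rmult_le_pos; assumption).
  apply Rle_trans with ((Cmod (w * e) + Cmod (RtoC (INR n) * z ^ n * (w - z) ^ 2)) * r)%R.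
  + apply Rmult_le_compat_r; [lra|apply Cmod_triangle].
  (* The two bounds add up because n^2 + n <= (n + 1)^2. *)
  + rewrite S_INR; simpl in *; nra.
Qed.

(** The points z and w are kept in a disc of radius r < 1, halfway between |z| and 1. Summing the
    second-order remainders bounds z times the error by |w - z|^2 B / r, where B is the sum of n^2
    |a_n| r^n. *)
Lemma Cderives_pseries (a : nat -> R) (z : C) :
  tempered a -> (Cmod z < 1)%R -> z <> 0 ->
  Cderives (pseries_sum a) z (pseries_sum (fun n => INR n * a n)%R z / z).
Proof.
intros Ha Hz Hz0; apply Cderives_eps; intros eps.
assert (Hm : (0 < Cmod z)%R) by (apply Cmod_gt_0; exact Hz0).
set (r := ((1 + Cmod z) / 2)%R).
assert (Hr : (Cmod z < r < 1)%R) by (unfold r; lra).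
assert (H1 : tempered (fun n => INR n * a n)%R).
{ destruct (tempered_pow_mult 1 a Ha) as [M [p H]]; exists M, p; intros n.
  specialize (H n); now rewrite pow_1 in H. }
assert (H2 := tempered_pow_mult 2 a Ha).
assert (He := ex_series_tempered _ r H2 (conj (Rlt_le _ _ (Rlt_trans _ _ _ Hm (proj1 Hr))) (proj2 Hr))).
destruct He as [B HB].
assert (HB0 : (0 <= B)%R).
{ rewrite <- (is_series_unique _ _ HB).
  rewrite <- (Rmult_0_l (Series (fun _ => 0%R))), <- Series_scal_l.
  apply Series_le; [|exists B; exact HB].
  intros n; split; [lra|]; rewrite Rmult_0_l.
  apply Rmult_le_pos; [apply Rabs_pos|apply pow_le; lra]. }
(* The first bound keeps |w| <= r; the second makes |w - z| B / (r |z|) at most eps, with 1 + B as a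
   denominator that cannot vanish. *)
assert (Hd : (0 < Rmin (r - Cmod z) (eps * (r * Cmod z) / (1 + B)))%R).
{ apply Rmin_glb_lt; [lra|]; apply Rdiv_lt_0_compat; [|lra].
  apply Rmult_lt_0_compat; [apply cond_pos|nra]. }
exists (mkposreal _ Hd); simpl; intros w Hw.
assert (Hw1 := Rlt_le_trans _ _ _ Hw (Rmin_l _ _)).
assert (Hw2 := Rlt_le_trans _ _ _ Hw (Rmin_r _ _)).
assert (Hwr : (Cmod w <= r)%R).
{ assert (Hc := Cmod_minus_abs z w); apply Rabs_le_between in Hc; lra. }
assert (Hs : Cis_series
  (fun n => z * (pseries_term a w n + - (1) * pseries_term a z n)
            + - (w - z) * pseries_term (fun n => INR n * a n)%R z n)
  (z * (pseries_sum a w + - (1) * pseries_sum a z)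
     + - (w - z) * pseries_sum (fun n => INR n * a n)%R z)).
{ apply Cis_series_plus; apply Cis_series_scal;
    [apply Cis_series_plus; [|apply Cis_series_scal]|];
    apply pseries_sum_correct; try assumption; lra. }
assert (Hb := Cis_series_bound _
  (fun n => (Cmod (w - z) ^ 2 / r) * (Rabs (INR (S n) ^ 2 * a (S n)) * r ^ S n))%R _
  (Cmod (w - z) ^ 2 / r * B)%R Hs).
assert (HBs := is_series_scal (K := R_AbsRing) (V := R_NormedModule)
                 (Cmod (w - z) ^ 2 / r)%R _ _ HB).
specialize (Hb HBs).
assert (Hle : (Cmod (z * (pseries_sum a w + - (1) * pseries_sum a z)
     + - (w - z) * pseries_sum (fun n => INR n * a n)%R z) <= Cmod (w - z) ^ 2 / r * B)%R).
{ apply Hb; intros n.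
  replace (z * (pseries_term a w n + - (1) * pseries_term a z n)
            + - (w - z) * pseries_term (fun n => INR n * a n)%R z n)
    with (RtoC (a (S n)) * (z * (w ^ S n - z ^ S n)
            - (w - z) * (RtoC (INR (S n)) * z ^ S n))).
  2: { unfold pseries_term; rewrite RtoC_mult; ring. }
  assert (Ht := pow_taylor_bound z w r (S n) ltac:(lra) ltac:(lra) Hwr).
  rewrite Cmod_mult, Cmod_R, Rabs_mult.
  rewrite (Rabs_pos_eq (INR (S n) ^ 2)) by apply pow2_ge_0.
  apply (Rmult_le_reg_r r); [lra|].
  replace (Cmod (w - z) ^ 2 / r * (INR (S n) ^ 2 * Rabs (a (S n)) * r ^ S n) * r)%R
    with (Rabs (a (S n)) * (INR (S n) ^ 2 * r ^ S n * Cmod (w - z) ^ 2))%R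
    by (field; lra).
  rewrite Rmult_assoc; apply Rmult_le_compat_l; [apply Rabs_pos|exact Ht]. }
apply (Rmult_le_reg_l (Cmod z)); [exact Hm|].
rewrite <- Cmod_mult.
replace (z * (pseries_sum a w - pseries_sum a z
           - (w - z) * (pseries_sum (fun n => INR n * a n)%R z / z)))
  with (z * (pseries_sum a w + - (1) * pseries_sum a z)
     + - (w - z) * pseries_sum (fun n => INR n * a n)%R z)
  by (field; exact Hz0).
eapply Rle_trans; [exact Hle|].
assert (Hwz := Cmod_ge_0 (w - z)).
apply (Rmult_lt_compat_r (1 + B)) in Hw2; [|lra].
replace (eps * (r * Cmod z) / (1 + B) * (1 + B))%R with (eps * (r * Cmod z))%R in Hw2
  by (field; lra).
apply (Rmult_le_reg_r r); [lra|].
replace (Cmod (w - z) ^ 2 / r * B * r)%R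
  with (Cmod (w - z) * (Cmod (w - z) * B))%R by (field; lra).
replace (Cmod z * (eps * Cmod (w - z)) * r)%R
  with (Cmod (w - z) * (eps * (r * Cmod z)))%R by ring.
apply Rmult_le_compat_l; [exact Hwz|]; nra.
Qed.

(** * A basis criterion and the factorisation of the operator *)

Lemma lincomb_ext (d : nat) (c c' : nat -> C) (w : nat -> C -> C) (z : C) :
  (forall i, (i < d)%nat -> c i = c' i) -> lincomb d c w z = lincomb d c' w z.
Proof.
induction d as [|d IH]; simpl; intros E; [reflexivity|].
rewrite IH, E; [reflexivity|lia|intros; apply E; lia].
Qed.

(** The peeling argument uses only formal properties of the tower T_i on a class [H] of functions,
    so it is separated from the analysis. The extensionality hypotheses reflect that total functions
    are compared on D alone. *)
Section BasisCriterion.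

Variables (D : C -> Prop) (p0 : C) (H : (C -> C) -> Prop)
  (T : nat -> (C -> C) -> C -> C) (d : nat) (w : nat -> C -> C) (gam : nat -> C).
Hypothesis Dp0 : D p0.
Hypothesis H_ext : forall f g, (forall z, D z -> f z = g z) -> H f -> H g.
Hypothesis T_ext : forall i f g z, (forall z, D z -> f z = g z) -> H f ->
  (i <= d)%nat -> D z -> T i g z = T i f z.
Hypothesis H_lin : forall f g c, H f -> H g -> H (fun z => f z + c * g z).
Hypothesis T_lin : forall i f g c z, H f -> H g -> (i <= d)%nat -> D z ->
  T i (fun z => f z + c * g z) z = T i f z + c * T i g z.
Hypothesis H_0 : H (fun _ => 0).
Hypothesis T_id : forall f z, D z -> T 0 f z = f z.
Hypothesis T_antiderivative : forall i f, H f -> (i < d)%nat ->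
  (forall z, D z -> T (S i) f z = 0) -> forall z, D z -> T i f z = T i f p0.
Hypothesis T_of_const : forall i f c, H f -> (i < d)%nat ->
  (forall z, D z -> T i f z = c) -> forall z, D z -> T (S i) f z = 0.
Hypothesis H_w : forall i, (i < d)%nat -> H (w i).
Hypothesis gam_neq_0 : forall i, (i < d)%nat -> gam i <> 0.
Hypothesis T_w : forall i z, (i < d)%nat -> D z -> T i (w i) z = gam i.

Lemma T_zero (i : nat) (z : C) : (i <= d)%nat -> D z -> T i (fun _ => 0) z = 0.
Proof.
intros Hi Hz.
(* Linearity is available only for f + c g; writing 0 as 0 - 1 * 0 turns the value into T 0 - T
   0. *)
rewrite (T_ext i (fun z => 0 + - (1) * 0)); [|intros; ring|now apply H_lin|exact Hi|exact Hz].
rewrite (T_lin i (fun _ => 0) (fun _ => 0)); trivial; ring.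
Qed.

(** The combination is treated as a whole: T_m kills the first m terms, so T_m of m + 1 terms is the
    constant c_m gam_m, and T_{m+1} kills it. *)
Lemma lincomb_annihilated (m : nat) (c : nat -> C) : (m <= d)%nat ->
  H (lincomb m c w) /\ forall z, D z -> T m (lincomb m c w) z = 0.
Proof.
induction m as [|m IH]; intros Hm; simpl.
- split; [exact H_0|]; intros; now apply T_zero.
- destruct IH as [IH1 IH2]; [lia|].
  assert (Hw := H_w m Hm).
  split; [exact (H_lin _ _ _ IH1 Hw)|].
  apply (T_of_const m _ (c m * gam m)); [exact (H_lin _ _ _ IH1 Hw)|lia|].
  intros z Hz; rewrite (T_lin m (lincomb m c w) (w m) (c m)) by (trivial; lia).
  rewrite IH2, T_w by (trivial; lia); ring.
Qed.

Lemma lincomb_independent (m : nat) (c : nat -> C) : (m <= d)%nat ->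
  (forall z, D z -> lincomb m c w z = 0) -> forall i, (i < m)%nat -> c i = 0.
Proof.
induction m as [|m IH]; intros Hm E i Hi; [lia|].
destruct (lincomb_annihilated m c ltac:(lia)) as [H1 H2].
assert (Hw := H_w m Hm).
assert (Hc : c m = 0).
{ assert (Et : T m (lincomb (S m) c w) p0 = 0).
  { rewrite (T_ext m (fun _ => 0)); [apply T_zero| | | |]; trivial; try lia.
    intros z Hz; now rewrite E. }
  simpl in Et; rewrite (T_lin m (lincomb m c w) (w m) (c m)) in Et by (trivial; lia).
  rewrite H2, T_w in Et by (trivial; lia).
  replace (c m) with ((0 + c m * gam m) * / gam m) by (field; now apply gam_neq_0).
  rewrite Et; ring. }
destruct (Nat.eq_dec i m) as [->|Hne]; [exact Hc|].
apply IH; [lia| |lia].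
intros z Hz; specialize (E z Hz); simpl in E; rewrite Hc in E.
rewrite <- E; ring.
Qed.

Lemma annihilated_in_span (m : nat) (f : C -> C) : (m <= d)%nat ->
  H f -> (forall z, D z -> T m f z = 0) ->
  exists c, forall z, D z -> f z = lincomb m c w z.
Proof.
revert f; induction m as [|m IH]; intros f Hm Hf E.
- exists (fun _ => 0); intros z Hz; rewrite <- T_id by exact Hz; now apply E.
- assert (Hw := H_w m Hm); assert (Hg := gam_neq_0 m Hm).
  (* T_m f is constant on D, so its value at [p0] gives the coefficient that makes T_m (f - a w_m)
     vanish on all of D. *)
  set (a := T m f p0 / gam m).
  destruct (IH (fun z => f z + - a * w m z)) as [c Hc].
  + lia.
  + now apply H_lin.
  + intros z Hz; rewrite T_lin by (trivial; lia).
    rewrite (T_antiderivative m f) by (trivial; lia).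
    rewrite T_w by trivial; unfold a; field; exact Hg.
  + exists (fun i => if Nat.eqb i m then a else c i).
    intros z Hz; simpl; rewrite Nat.eqb_refl.
    rewrite (lincomb_ext m _ c).
    * rewrite <- Hc by exact Hz; ring.
    * intros i Hi; now rewrite (proj2 (Nat.eqb_neq i m) ltac:(lia)).
Qed.

Lemma basis_criterion :
  is_basis D (fun f => H f /\ forall z, D z -> T d f z = 0) d w.
Proof.
split.
- intros c E; apply lincomb_independent; [lia|exact E].
- intros f; split.
  + intros [Hf E]; apply annihilated_in_span; trivial; lia.
  + intros [c E]; destruct (lincomb_annihilated d c (le_n d)) as [H1 H2].
    assert (E' : forall z, D z -> lincomb d c w z = f z)
      by (intros z Hz; symmetry; now apply E).
    split; [now apply (H_ext (lincomb d c w))|].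
    intros z Hz; rewrite (T_ext d _ f z E' H1 (le_n d) Hz); now apply H2.
Qed.

End BasisCriterion.

(** * Iterates of theta and the right factors of the operator *)

Definition theta_holomorphic (n : nat) (f : C -> C) : Prop :=
  forall j : nat, (j < n)%nat -> holomorphic_on slit_disc (theta_iter j f).

Lemma Cderives_theta (n j : nat) (f : C -> C) (z : C) :
  theta_holomorphic n f -> (j < n)%nat -> slit_disc z ->
  Cderives (theta_iter j f) z (theta_iter (S j) f z / z).
Proof.
intros Hf Hj Hz.
replace (theta_iter (S j) f z / z) with (C_derive (theta_iter j f) z).
- exact (C_derive_correct (theta_iter j f) z 0 (Hf j Hj z Hz)).
- change (theta_iter (S j) f z) with (z * C_derive (theta_iter j f) z).
  field; exact (slit_disc_nonzero z Hz).
Qed.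

(** The induction keeps the equality of G_j with theta^j f on the whole slit disc; since the disc is
    open, the derivative of G_j is then that of theta^j f. All later evaluations and closure
    properties of theta^j go through such a chain. *)
Lemma theta_iter_chain (n : nat) (f : C -> C) (G : nat -> C -> C) :
  (forall z, slit_disc z -> G 0%nat z = f z) ->
  (forall j z, (j < n)%nat -> slit_disc z ->
     Cderives (G j) z (G (S j) z / z)) ->
  theta_holomorphic n f /\
  forall j z, (j <= n)%nat -> slit_disc z -> theta_iter j f z = G j z.
Proof.
intros E0 HG.
assert (E : forall j z, (j <= n)%nat -> slit_disc z -> G j z = theta_iter j f z).
{ induction j as [|j IH]; intros z Hj Hz; [exact (E0 z Hz)|].
  change (theta_iter (S j) f z) with (z * C_derive (theta_iter j f) z).
  rewrite (is_C_derive_unique _ _ (G (S j) z / z)).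
  - field; exact (slit_disc_nonzero z Hz).
  - apply (Cderives_ext slit_disc (G j)); [now apply slit_disc_open| |].
    + intros x Hx; apply IH; [lia|exact Hx].
    + apply HG; [lia|exact Hz]. }
split.
- intros j Hj z Hz; exists (G (S j) z / z).
  apply (Cderives_ext slit_disc (G j)); [now apply slit_disc_open| |].
  + intros x Hx; apply E; [lia|exact Hx].
  + now apply HG.
- intros j z Hj Hz; symmetry; now apply E.
Qed.

(* The partial products of the factorisation
   [Dop k = theta (1 + z) theta (1 + z) theta ^ k]. *)
Definition Dfactor (k i : nat) (f : C -> C) (z : C) : C :=
  if Nat.ltb i k then theta_iter i f z
  else if Nat.eqb i k then (1 + z) * theta_iter k f z
  else if Nat.eqb i (k + 1) then
    (1 + z) * (z * theta_iter k f z + (1 + z) * theta_iter (k + 1) f z)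
  else Dop k f z.

Lemma Dfactor_lt (k i : nat) (f : C -> C) (z : C) :
  (i < k)%nat -> Dfactor k i f z = theta_iter i f z.
Proof. intros Hi; unfold Dfactor; now rewrite (proj2 (Nat.ltb_lt i k) Hi). Qed.

Lemma Dfactor_k (k : nat) (f : C -> C) (z : C) :
  Dfactor k k f z = (1 + z) * theta_iter k f z.
Proof. unfold Dfactor; now rewrite Nat.ltb_irrefl, Nat.eqb_refl. Qed.

Lemma Dfactor_k1 (k : nat) (f : C -> C) (z : C) :
  Dfactor k (k + 1) f z
  = (1 + z) * (z * theta_iter k f z + (1 + z) * theta_iter (k + 1) f z).
Proof.
unfold Dfactor.
rewrite (proj2 (Nat.ltb_ge (k + 1) k) ltac:(lia)).
now rewrite (proj2 (Nat.eqb_neq (k + 1) k) ltac:(lia)), Nat.eqb_refl.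
Qed.

Lemma Dfactor_k2 (k : nat) (f : C -> C) (z : C) :
  Dfactor k (k + 2) f z = Dop k f z.
Proof.
unfold Dfactor.
rewrite (proj2 (Nat.ltb_ge (k + 2) k) ltac:(lia)).
rewrite (proj2 (Nat.eqb_neq (k + 2) k) ltac:(lia)).
now rewrite (proj2 (Nat.eqb_neq (k + 2) (k + 1)) ltac:(lia)).
Qed.

Lemma Dfactor_lin (k i : nat) (f g h : C -> C) (c z : C) :
  (forall j, (j <= k + 2)%nat ->
     theta_iter j h z = theta_iter j f z + c * theta_iter j g z) ->
  Dfactor k i h z = Dfactor k i f z + c * Dfactor k i g z.
Proof.
intros E; unfold Dfactor, Dop.
destruct (Nat.ltb_spec i k); [apply E; lia|].
rewrite !E by lia.
destruct (Nat.eqb i k); [ring|]; destruct (Nat.eqb i (k + 1)); ring.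
Qed.

(** The multiplier m_i of the factorisation: it is 1 + z at the steps i = k - 1 and i = k, which
    produce T_k and T_{k+1}. *)
Definition Dweight (k i : nat) (z : C) : C :=
  if orb (Nat.eqb (S i) k) (Nat.eqb i k) then 1 + z else 1.

Lemma Cderives_eq (f : C -> C) (z l l' : C) :
  Cderives f z l -> l = l' -> Cderives f z l'.
Proof. intros H <-; exact H. Qed.

Lemma Cderives_1_plus (z : C) : Cderives (fun w => 1 + w) z 1.
Proof.
apply (Cderives_eq _ _ (0 + 1)); [|ring].
apply (Cderives_plus (fun _ => 1) (fun w => w)); [apply Cderives_const|apply Cderives_id].
Qed.

Lemma Cderives_Dfactor (k i : nat) (f : C -> C) (z : C) :
  theta_holomorphic (k + 2) f -> (i < k + 2)%nat -> slit_disc z ->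
  Cderives (Dfactor k i f) z (Dfactor k (S i) f z / (Dweight k i z * z)).
Proof.
intros Hf Hi Hz.
assert (Hz0 := slit_disc_nonzero z Hz).
assert (Hz1 := Cplus_1_nonzero z (proj1 Hz)).
assert (H1 := Cderives_1_plus z).
destruct (Nat.lt_ge_cases i k) as [Hik|Hik].
- apply (Cderives_ext slit_disc (theta_iter i f)); [now apply slit_disc_open| |].
  { intros x _; symmetry; now apply Dfactor_lt. }
  apply (Cderives_eq _ _ _ _ (Cderives_theta (k + 2) i f z Hf Hi Hz)).
  unfold Dweight; rewrite (proj2 (Nat.eqb_neq i k) ltac:(lia)), Bool.orb_false_r.
  destruct (Nat.eqb_spec (S i) k) as [<-|Hne].
  + rewrite Dfactor_k; field; split; assumption.
  + rewrite Dfactor_lt by lia; field; exact Hz0.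
- assert (Hk := Cderives_theta (k + 2) k f z Hf ltac:(lia) Hz).
  replace (S k) with (k + 1)%nat in Hk by lia.
  destruct (Nat.eq_dec i k) as [->|Hne].
  + apply (Cderives_ext slit_disc (fun x => (1 + x) * theta_iter k f x));
      [now apply slit_disc_open| |].
    { intros x _; symmetry; apply Dfactor_k. }
    apply (Cderives_eq _ _ _ _ (Cderives_mult _ _ _ _ _ H1 Hk)).
    replace (S k) with (k + 1)%nat by lia; rewrite Dfactor_k1.
    unfold Dweight; rewrite Nat.eqb_refl, Bool.orb_true_r.
    field; split; assumption.
  + replace i with (k + 1)%nat by lia.
    assert (Hk1 := Cderives_theta (k + 2) (k + 1) f z Hf ltac:(lia) Hz).
    replace (S (k + 1)) with (k + 2)%nat in * by lia.
    apply (Cderives_ext slit_disc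
             (fun x => (1 + x) * (x * theta_iter k f x + (1 + x) * theta_iter (k + 1) f x)));
      [now apply slit_disc_open| |].
    { intros x _; symmetry; apply Dfactor_k1. }
    (* With g = theta^k f, the three terms z (1 + z) theta g give the coefficient 3 z (1 + z), and
       z^2 + (1 + z) z gives z (1 + 2 z). *)
    assert (H2 := Cderives_mult _ _ _ _ _ H1
              (Cderives_plus _ _ _ _ _
                 (Cderives_mult _ _ _ _ _ (Cderives_id z) Hk)
                 (Cderives_mult _ _ _ _ _ H1 Hk1))).
    apply (Cderives_eq _ _ _ _ H2).
    rewrite Dfactor_k2; unfold Dweight, Dop.
    rewrite (proj2 (Nat.eqb_neq (S (k + 1)) k) ltac:(lia)).
    rewrite (proj2 (Nat.eqb_neq (k + 1) k) ltac:(lia)); simpl orb; cbv iota.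
    simpl Cpow; field; exact Hz0.
Qed.

Lemma Dweight_neq_0 (k i : nat) (z : C) : slit_disc z -> Dweight k i z * z <> 0.
Proof.
intros Hz; apply Cmult_neq_0; [|now apply slit_disc_nonzero].
unfold Dweight; destruct (orb _ _); [now apply Cplus_1_nonzero, (proj1 Hz)|].
intros E; apply RtoC_inj in E; lra.
Qed.

Lemma theta_holomorphic_lin (n : nat) (f g : C -> C) (c : C) :
  theta_holomorphic n f -> theta_holomorphic n g ->
  theta_holomorphic n (fun z => f z + c * g z) /\
  forall j z, (j <= n)%nat -> slit_disc z ->
    theta_iter j (fun z => f z + c * g z) z = theta_iter j f z + c * theta_iter j g z.
Proof.
intros Hf Hg.
apply (theta_iter_chain n _ (fun j z => theta_iter j f z + c * theta_iter j g z)).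
- reflexivity.
- intros j z Hj Hz.
  assert (H := Cderives_plus _ _ _ _ _ (Cderives_theta n j f z Hf Hj Hz)
     (Cderives_mult _ _ _ _ _ (Cderives_const c z) (Cderives_theta n j g z Hg Hj Hz))).
  apply (Cderives_eq _ _ _ _ H); field; exact (slit_disc_nonzero z Hz).
Qed.

Lemma theta_holomorphic_ext (n : nat) (f g : C -> C) :
  (forall z, slit_disc z -> f z = g z) -> theta_holomorphic n f ->
  theta_holomorphic n g /\
  forall j z, (j <= n)%nat -> slit_disc z -> theta_iter j g z = theta_iter j f z.
Proof.
intros E Hf; apply (theta_iter_chain n g (fun j => theta_iter j f)); [exact E|].
intros; now apply (Cderives_theta n).
Qed.

Lemma theta_holomorphic_zero (n : nat) : theta_holomorphic n (fun _ => 0).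
Proof.
apply (theta_iter_chain n _ (fun _ _ => 0)); [reflexivity|].
intros j z _ Hz; apply (Cderives_eq _ _ 0); [apply Cderives_const|].
field; exact (slit_disc_nonzero z Hz).
Qed.

Lemma solutions_basis (k : nat) (w : nat -> C -> C) (gam : nat -> C) :
  (1 <= k)%nat ->
  (forall i, (i < k + 2)%nat -> theta_holomorphic (k + 2) (w i)) ->
  (forall i, (i < k + 2)%nat -> gam i <> 0) ->
  (forall i z, (i < k + 2)%nat -> slit_disc z -> Dfactor k i (w i) z = gam i) ->
  is_basis slit_disc (holomorphic_solution k) (k + 2) w.
Proof.
intros hk Hw Hg HT.
assert (B := basis_criterion slit_disc (RtoC (/ 2)) (theta_holomorphic (k + 2))
               (Dfactor k) (k + 2) w gam slit_disc_half).
unfold holomorphic_solution.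
cut (is_basis slit_disc (fun f => theta_holomorphic (k + 2) f /\
       forall z, slit_disc z -> Dfactor k (k + 2) f z = 0) (k + 2) w).
{ intros [B1 B2]; split; [exact B1|]; intros f; rewrite <- B2; split.
  - intros [F1 F2]; split; [exact F1|]; intros z Hz; rewrite Dfactor_k2; now apply F2.
  - intros [F1 F2]; split; [exact F1|]; intros z Hz; rewrite <- Dfactor_k2; now apply F2. }
apply B; clear B; trivial.
- intros f g E Hf; exact (proj1 (theta_holomorphic_ext _ f g E Hf)).
- intros i f g z E Hf Hi Hz.
  (* Extensionality is obtained as the case c = 0 of linearity. *)
  replace (Dfactor k i f z) with (Dfactor k i f z + 0 * Dfactor k i f z) by ring.
  apply Dfactor_lin; intros j Hj.
  rewrite (proj2 (theta_holomorphic_ext _ f g E Hf) j z Hj Hz); ring.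
- intros f g c Hf Hg'; exact (proj1 (theta_holomorphic_lin _ f g c Hf Hg')).
- intros i f g c z Hf Hg' Hi Hz; apply Dfactor_lin; intros j Hj.
  exact (proj2 (theta_holomorphic_lin _ f g c Hf Hg') j z Hj Hz).
- apply theta_holomorphic_zero.
- intros f z Hz; now rewrite Dfactor_lt by lia.
- intros i f Hf Hi E z Hz.
  apply (constant_on_slit_disc (Dfactor k i f)); [|exact Hz].
  intros x Hx; apply (Cderives_eq _ _ _ _ (Cderives_Dfactor k i f x Hf Hi Hx)).
  rewrite (E x Hx); field.
  assert (H := Dweight_neq_0 k i x Hx); split; intros E'; apply H; rewrite E'; ring.
- intros i f c Hf Hi E z Hz.
  assert (H := Cderives_Dfactor k i f z Hf Hi Hz).
  assert (H0 : Cderives (Dfactor k i f) z 0).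
  { apply (Cderives_ext slit_disc (fun _ => c)); [now apply slit_disc_open| |].
    - intros x Hx; symmetry; now apply E.
    - apply Cderives_const. }
  assert (E0 := Cderives_unique _ _ _ _ H H0).
  assert (Hn := Dweight_neq_0 k i z Hz).
  replace (Dfactor k (S i) f z)
    with (Dfactor k (S i) f z / (Dweight k i z * z) * (Dweight k i z * z)).
  + rewrite E0; ring.
  + field; split; intros E'; apply Hn; rewrite E'; ring.
Qed.

(** * The explicit solutions *)

(** The coefficient n (n-1) ... (n-j+1) of theta^j log^n. Truncated subtraction makes it 0 for j >
    n, so the chain of log^n stays correct after it has reached a constant. *)
Fixpoint falling (n j : nat) : nat :=
  match j with O => 1 | S j' => falling n j' * (n - j') end.

Lemma falling_fact (n j : nat) :
  (j <= n)%nat -> (falling n j * fact (n - j) = fact n)%nat.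
Proof.
induction j as [|j IH]; intros Hj; simpl falling.
- rewrite Nat.sub_0_r; lia.
- rewrite <- IH by lia; replace (n - j)%nat with (S (n - S j)) by lia.
  change (fact (S (n - S j))) with (S (n - S j) * fact (n - S j))%nat; lia.
Qed.

Lemma falling_diag (n : nat) : falling n n = fact n.
Proof.
rewrite <- (falling_fact n n (le_n n)), Nat.sub_diag; simpl; lia.
Qed.

Lemma falling_pred (n : nat) : falling (n + 1) n = fact (n + 1).
Proof.
rewrite <- (falling_fact (n + 1) n) by lia.
replace (n + 1 - n)%nat with 1%nat by lia; simpl; lia.
Qed.

Definition log_chain (n j : nat) (z : C) : C :=
  RtoC (INR (falling n j)) * Clog z ^ (n - j).

Lemma Cderives_log_chain (n j : nat) (z : C) : slit_disc z ->
  Cderives (log_chain n j) z (log_chain n (S j) z / z).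
Proof.
intros Hz.
apply (Cderives_eq _ _ _ _ (Cderives_mult _ _ _ _ _
         (Cderives_const (RtoC (INR (falling n j))) z)
         (Cderives_pow Clog (n - j) z _ (Cderives_Clog z (proj2 Hz))))).
unfold log_chain; simpl falling; rewrite mult_INR, RtoC_mult.
replace (n - S j)%nat with (n - j - 1)%nat by lia.
field; exact (slit_disc_nonzero z Hz).
Qed.

Definition psum_chain (a : nat -> R) (j : nat) : C -> C :=
  pseries_sum (fun n => INR n ^ j * a n)%R.

Lemma Cderives_psum_chain (a : nat -> R) (j : nat) (z : C) :
  tempered a -> slit_disc z ->
  Cderives (psum_chain a j) z (psum_chain a (S j) z / z).
Proof.
intros Ha Hz.
apply (Cderives_eq _ _ _ _ (Cderives_pseries _ z (tempered_pow_mult j a Ha)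
         (proj1 Hz) (slit_disc_nonzero z Hz))).
unfold psum_chain; f_equal; apply pseries_sum_ext; intros n.
rewrite <- tech_pow_Rmult; ring.
Qed.

Lemma psum_chain_0 (a : nat -> R) (z : C) : psum_chain a 0 z = pseries_sum a z.
Proof. apply pseries_sum_ext; intros n; ring. Qed.

(** * Growth of the coefficients *)

Lemma INR_S_ge_1 (n : nat) : (1 <= INR (S n))%R.
Proof. rewrite S_INR; assert (H := pos_INR n); lra. Qed.

Lemma abs_div_INR_pow (x : R) (n p : nat) : (Rabs (x / INR (S n) ^ p) <= Rabs x)%R.
Proof.
assert (H : (1 <= INR (S n) ^ p)%R) by apply pow_R1_Rle, INR_S_ge_1.
unfold Rdiv; rewrite Rabs_mult, Rabs_inv, (Rabs_pos_eq (INR (S n) ^ p)) by lra.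
rewrite <- (Rmult_1_r (Rabs x)) at 2.
apply Rmult_le_compat_l; [apply Rabs_pos|].
rewrite <- Rinv_1; apply Rinv_le_contravar; lra.
Qed.

Lemma harmonic_S (n : nat) : harmonic (S n) = (harmonic n + / INR (S n))%R.
Proof.
unfold harmonic; rewrite sum_n_Sm by lia; reflexivity.
Qed.

Lemma harmonic_bounds (n : nat) : (0 <= harmonic n <= INR n)%R.
Proof.
induction n as [|n IH].
- unfold harmonic; rewrite sum_n_m_zero by lia; unfold zero; simpl; lra.
- rewrite harmonic_S; assert (H := INR_S_ge_1 n).
  assert (H1 : (0 < / INR (S n))%R) by (apply Rinv_0_lt_compat; lra).
  assert (H2 : (/ INR (S n) <= 1)%R).
  { rewrite <- Rinv_1; apply Rinv_le_contravar; lra. }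
  rewrite (S_INR n) in *; lra.
Qed.

Lemma tempered_coef0 (k : nat) : tempered (coef0 k).
Proof.
exists (INR (fact k)), 0%nat; intros n; unfold coef0.
rewrite Rabs_mult, (Rabs_pos_eq _ (pos_INR _)).
apply Rmult_le_compat_l; [apply pos_INR|].
eapply Rle_trans; [apply abs_div_INR_pow|]; rewrite pow_1_abs; simpl; lra.
Qed.

Lemma tempered_coef1 (k : nat) : tempered (coef1 k).
Proof.
(* For n >= 1, H_n <= n gives |-k + n H_n| <= k + n^2 <= (k + 1) n^2; the denominator n^(k+1) >= 1
   is simply dropped. *)
exists (INR (fact (k + 1)) * (INR k + 1))%R, 2%nat; intros n; unfold coef1.
eapply Rle_trans; [apply abs_div_INR_pow|].
rewrite !Rabs_mult, pow_1_abs, (Rabs_pos_eq _ (pos_INR _)), Rmult_1_r, Rmult_assoc.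
apply Rmult_le_compat_l; [apply pos_INR|].
assert (H := INR_S_ge_1 n); assert (Hh := harmonic_bounds (S n)).
assert (Hk := pos_INR k).
apply Rabs_le; set (m := INR (S n)) in *; set (h := harmonic (S n)) in *.
assert (0 <= m * h <= m * m)%R by (split; nra).
assert (INR k * 1 <= INR k * (m * m))%R by (apply Rmult_le_compat_l; nra).
simpl; split; nra.
Qed.

Lemma tempered_sign : tempered (fun n => (-1) ^ n)%R.
Proof.
exists 1%R, 0%nat; intros n; rewrite pow_1_abs; simpl; lra.
Qed.

Lemma tempered_sign_harmonic : tempered (fun n => (-1) ^ n * harmonic n)%R.
Proof.
exists 1%R, 1%nat; intros n; assert (H := harmonic_bounds (S n)).
rewrite Rabs_mult, pow_1_abs, Rabs_pos_eq, pow_1; lra.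
Qed.

Lemma tempered_sign_inv : tempered (fun n => (-1) ^ n * / INR n)%R.
Proof.
exists 1%R, 0%nat; intros n.
assert (H := abs_div_INR_pow ((-1) ^ S n) n 1).
rewrite pow_1, pow_1_abs in H; unfold Rdiv in H; simpl pow at 2; lra.
Qed.

(** * Series appearing in the theta-iterates of the solutions *)

Lemma pseries_sum_sign (z : C) : (Cmod z < 1)%R ->
  (1 + z) * pseries_sum (fun n => (-1) ^ n)%R z = - z.
Proof.
intros Hz.
(* Consecutive coefficients of the geometric series cancel under 1 + z, which leaves the linear
   term. *)
rewrite (pseries_sum_1_plus _ (fun n => if Nat.eqb n 1 then (-1)%R else 0%R));
  [|exact tempered_sign|exact Hz|simpl; ring|intros n; simpl; ring].
rewrite pseries_sum_linear_term by reflexivity.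
simpl; replace (RtoC (-1)) with (- (1)); [ring|].
now rewrite <- RtoC_opp.
Qed.

Lemma pseries_sum_sign_harmonic (z : C) : (Cmod z < 1)%R ->
  (1 + z) * pseries_sum (fun n => (-1) ^ n * harmonic n)%R z
  = pseries_sum (fun n => (-1) ^ n * / INR n)%R z.
Proof.
intros Hz; apply pseries_sum_1_plus; [exact tempered_sign_harmonic|exact Hz| |].
- rewrite harmonic_S; unfold harmonic; rewrite sum_n_m_zero by lia.
  unfold zero; simpl; ring.
- intros n; rewrite (harmonic_S (S n)); simpl pow; ring.
Qed.

Lemma psum_chain_coef0 (k : nat) (z : C) : (Cmod z < 1)%R ->
  psum_chain (coef0 k) k z = RtoC (INR (fact k)) * (- z / (1 + z)).
Proof.
intros Hz.
rewrite <- (pseries_sum_sign z Hz).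
(* The added zero multiple brings the expression into the form of [pseries_sum_lin]. *)
replace (RtoC (INR (fact k)) * ((1 + z) * pseries_sum (fun n => (-1) ^ n)%R z / (1 + z)))
  with (RtoC (INR (fact k)) * pseries_sum (fun n => (-1) ^ n)%R z
        + RtoC 0 * pseries_sum (fun n => (-1) ^ n)%R z)
  by (field; exact (Cplus_1_nonzero z Hz)).
rewrite <- pseries_sum_lin by (trivial; exact tempered_sign).
apply pseries_sum_ext; intros n; unfold coef0.
field; apply pow_nonzero; assert (H := INR_S_ge_1 n); lra.
Qed.

(** The first term is the Leibniz contribution of the product with the logarithm, with coefficients
    (k+1)! k (-1)^n / n; it cancels the -k in [coef1]. *)
Lemma psum_chain_coef1 (k : nat) (z : C) : (1 <= k)%nat -> (Cmod z < 1)%R ->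
  RtoC (INR (k + 1)) * RtoC (INR k) * psum_chain (coef0 k) (k - 1) z
    + psum_chain (coef1 k) k z
  = RtoC (INR (fact (k + 1))) * pseries_sum (fun n => (-1) ^ n * harmonic n)%R z.
Proof.
intros Hk Hz.
transitivity (RtoC (INR (fact (k + 1))) * pseries_sum (fun n => (-1) ^ n * harmonic n)%R z
  + RtoC 0 * pseries_sum (fun n => (-1) ^ n * harmonic n)%R z); [|ring].
rewrite <- pseries_sum_lin by (trivial; exact tempered_sign_harmonic).
replace (psum_chain (coef1 k) k z) with (RtoC 1 * psum_chain (coef1 k) k z) by ring.
rewrite <- RtoC_mult; unfold psum_chain.
rewrite <- pseries_sum_lin; trivial.
2: apply tempered_pow_mult, tempered_coef0.
2: apply tempered_pow_mult, tempered_coef1.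
apply pseries_sum_ext; intros n; unfold coef0, coef1.
replace (k + 1)%nat with (S k) by lia.
change (fact (S k)) with (S k * fact k)%nat; rewrite mult_INR.
destruct k as [|k]; [lia|]; replace (S k - 1)%nat with k by lia.
assert (H := INR_S_ge_1 n).
assert (Hp : (INR (S n) ^ k <> 0)%R) by (apply pow_nonzero; lra).
set (m := INR (S n)) in *.
change (m ^ S (S k))%R with (m * (m * m ^ k))%R.
change (m ^ S k)%R with (m * m ^ k)%R.
field; split; [exact Hp|lra].
Qed.

(** The closed form of theta^j of each solution. As theta log = 1 and theta^2 log = 0, the Leibniz
    rule for S log has only two terms, theta^j S log + j theta^(j-1) S. *)
Definition varpi_chain (k i j : nat) (z : C) : C :=
  if Nat.ltb i k then log_chain i j z
  else if Nat.eqb i k then log_chain k j z + psum_chain (coef0 k) j z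
  else log_chain (k + 1) j z
       + RtoC (INR (k + 1)) * (psum_chain (coef0 k) j z * Clog z
           + RtoC (INR j) * psum_chain (coef0 k) (j - 1) z)
       + psum_chain (coef1 k) j z.

Lemma log_chain_0 (n : nat) (z : C) : log_chain n 0 z = Clog z ^ n.
Proof. unfold log_chain; rewrite Nat.sub_0_r; simpl; ring. Qed.

Lemma varpi_chain_0 (k i : nat) (z : C) : varpi_chain k i 0 z = varpi k i z.
Proof.
unfold varpi_chain, varpi.
destruct (Nat.ltb i k); [apply log_chain_0|].
destruct (Nat.eqb i k); rewrite log_chain_0, !psum_chain_0; simpl (INR 0); ring.
Qed.

Lemma Cderives_varpi_chain (k i j : nat) (z : C) : slit_disc z ->
  Cderives (varpi_chain k i j) z (varpi_chain k i (S j) z / z).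
Proof.
intros Hz; assert (Hz0 := slit_disc_nonzero z Hz).
assert (H0 := tempered_coef0 k); assert (H1 := tempered_coef1 k).
unfold varpi_chain; destruct (Nat.ltb i k); [now apply Cderives_log_chain|].
destruct (Nat.eqb i k).
- apply (Cderives_eq _ _ _ _ (Cderives_plus _ _ _ _ _
           (Cderives_log_chain k j z Hz) (Cderives_psum_chain _ j z H0 Hz))).
  field; exact Hz0.
- apply (Cderives_eq _ _ _ _ (Cderives_plus _ _ _ _ _
           (Cderives_plus _ _ _ _ _ (Cderives_log_chain (k + 1) j z Hz)
              (Cderives_mult _ _ _ _ _ (Cderives_const (RtoC (INR (k + 1))) z)
                 (Cderives_plus _ _ _ _ _
                    (Cderives_mult _ _ _ _ _ (Cderives_psum_chain _ j z H0 Hz)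
                       (Cderives_Clog z (proj2 Hz)))
                    (Cderives_mult _ _ _ _ _ (Cderives_const (RtoC (INR j)) z)
                       (Cderives_psum_chain _ (j - 1) z H0 Hz)))))
           (Cderives_psum_chain _ j z H1 Hz))).
  replace (S j - 1)%nat with j by lia; rewrite S_INR, RtoC_plus.
  (* For j = 0 the truncated index j - 1 is again 0, and the factor j of that term vanishes. *)
  destruct j as [|j].
  + simpl (INR 0); field; exact Hz0.
  + replace (S (S j - 1)) with (S j) by lia; field; exact Hz0.
Qed.

Lemma varpi_theta (k i : nat) :
  theta_holomorphic (k + 2) (varpi k i) /\
  forall j z, (j <= k + 2)%nat -> slit_disc z ->
    theta_iter j (varpi k i) z = varpi_chain k i j z.
Proof.
apply theta_iter_chain.
- intros; apply varpi_chain_0.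
- intros; now apply Cderives_varpi_chain.
Qed.

Lemma log_chain_diag (n : nat) (z : C) : log_chain n n z = RtoC (INR (fact n)).
Proof. unfold log_chain; rewrite falling_diag, Nat.sub_diag; simpl; ring. Qed.

Lemma Dfactor_k_varpi_k (k : nat) (z : C) : slit_disc z ->
  Dfactor k k (varpi k k) z = RtoC (INR (fact k)).
Proof.
intros Hz; rewrite Dfactor_k, (proj2 (varpi_theta k k)) by (trivial; lia).
unfold varpi_chain; rewrite Nat.ltb_irrefl, Nat.eqb_refl.
rewrite log_chain_diag, psum_chain_coef0 by apply Hz.
field; apply Cplus_1_nonzero, Hz.
Qed.

(** The logarithm keeps the coefficient (k+1)! because (1 + z) (1 - z / (1 + z)) = 1, and the
    harmonic series becomes the expansion of -log (1 + z). *)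
Lemma Dfactor_k_varpi_k1 (k : nat) (z : C) : (1 <= k)%nat -> slit_disc z ->
  Dfactor k k (varpi k (k + 1)) z
  = RtoC (INR (fact (k + 1)))
      * (Clog z + pseries_sum (fun n => (-1) ^ n * / INR n)%R z).
Proof.
intros Hk Hz; assert (Hz1 := Cplus_1_nonzero z (proj1 Hz)).
rewrite Dfactor_k, (proj2 (varpi_theta k (k + 1))) by (trivial; lia).
unfold varpi_chain.
rewrite (proj2 (Nat.ltb_ge (k + 1) k) ltac:(lia)).
rewrite (proj2 (Nat.eqb_neq (k + 1) k) ltac:(lia)).
rewrite <- pseries_sum_sign_harmonic by apply Hz.
replace (RtoC (INR (fact (k + 1)))
  * (Clog z + (1 + z) * pseries_sum (fun n => (-1) ^ n * harmonic n)%R z))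
  with (RtoC (INR (fact (k + 1))) * Clog z
    + (1 + z) * (RtoC (INR (fact (k + 1))) * pseries_sum (fun n => (-1) ^ n * harmonic n)%R z))
  by ring.
rewrite <- (psum_chain_coef1 k z Hk (proj1 Hz)), psum_chain_coef0 by apply Hz.
unfold log_chain; rewrite falling_pred.
replace (k + 1 - k)%nat with 1%nat by lia.
replace (fact (k + 1)) with ((k + 1) * fact k)%nat
  by (replace (k + 1)%nat with (S k) by lia; reflexivity).
rewrite mult_INR, RtoC_mult; simpl Cpow.
field; exact Hz1.
Qed.

(** The derivative of T_k is computed twice, from the factorisation and from the closed form, and
    the results are compared: theta of log z - log (1 + z) is 1 / (1 + z), which the weight 1 + z
    cancels. *)
Lemma Dfactor_k1_varpi_k1 (k : nat) (z : C) : (1 <= k)%nat -> slit_disc z ->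
  Dfactor k (k + 1) (varpi k (k + 1)) z = RtoC (INR (fact (k + 1))).
Proof.
intros Hk Hz.
assert (Hz0 := slit_disc_nonzero z Hz); assert (Hz1 := Cplus_1_nonzero z (proj1 Hz)).
assert (H := Cderives_Dfactor k k (varpi k (k + 1)) z
               (proj1 (varpi_theta k (k + 1))) ltac:(lia) Hz).
assert (H' : Cderives (Dfactor k k (varpi k (k + 1))) z
               (RtoC (INR (fact (k + 1))) * (/ z + (- z / (1 + z)) / z))).
{ apply (Cderives_ext slit_disc (fun x => RtoC (INR (fact (k + 1)))
           * (Clog x + pseries_sum (fun n => (-1) ^ n * / INR n)%R x)));
    [now apply slit_disc_open| |].
  - intros x Hx; symmetry; now apply Dfactor_k_varpi_k1.
  - apply (Cderives_eq _ _ _ _ (Cderives_mult _ _ _ _ _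
      (Cderives_const (RtoC (INR (fact (k + 1)))) z)
      (Cderives_plus _ _ _ _ _ (Cderives_Clog z (proj2 Hz))
         (Cderives_pseries _ z tempered_sign_inv (proj1 Hz) Hz0)))).
    rewrite (pseries_sum_ext (fun n => INR n * ((-1) ^ n * / INR n))%R
               (fun n => (-1) ^ n)%R).
    + rewrite <- (pseries_sum_sign z (proj1 Hz)); field; split; assumption.
    + intros n; field; assert (G := INR_S_ge_1 n); lra. }
assert (E := Cderives_unique _ _ _ _ H H').
unfold Dweight in E; rewrite Nat.eqb_refl, Bool.orb_true_r in E.
replace (k + 1)%nat with (S k) at 1 by lia.
replace (Dfactor k (S k) (varpi k (k + 1)) z)
  with (Dfactor k (S k) (varpi k (k + 1)) z / ((1 + z) * z) * ((1 + z) * z))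
  by (field; split; assumption).
rewrite E; field; split; assumption.
Qed.

Lemma varpi_basis (k : nat) : (1 <= k)%nat ->
  is_basis slit_disc (holomorphic_solution k) (k + 2) (varpi k).
Proof.
intros Hk; apply (solutions_basis k _ (fun i => RtoC (INR (fact i)))).
- exact Hk.
- intros i _; apply varpi_theta.
- intros i _ E; apply RtoC_inj in E; exact (INR_fact_neq_0 i E).
- intros i z Hi Hz; destruct (Nat.lt_trichotomy i k) as [Hik|[->|Hik]].
  + rewrite Dfactor_lt by exact Hik.
    rewrite (proj2 (varpi_theta k i)) by (trivial; lia).
    unfold varpi_chain; rewrite (proj2 (Nat.ltb_lt i k) Hik); apply log_chain_diag.
  + now apply Dfactor_k_varpi_k.
  + replace i with (k + 1)%nat by lia; now apply Dfactor_k1_varpi_k1.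
Qed.

(** Since [Series] is total, convergence is asserted separately, on the whole unit disc, to ensure
    that the formulas denote the actual sums. *)
Theorem proposition3p2 (k : nat) (hk : (2 <= k)%nat) :
  (forall z : C, (Cmod z < 1)%R ->
     is_series (K := C_AbsRing) (V := C_NormedModule)
       (pseries_term (coef0 k) z) (pseries_sum (coef0 k) z)
     /\ is_series (K := C_AbsRing) (V := C_NormedModule)
          (pseries_term (coef1 k) z) (pseries_sum (coef1 k) z))
  /\ has_dimension slit_disc (holomorphic_solution k) (k + 2)
  /\ is_basis slit_disc (holomorphic_solution k) (k + 2) (varpi k).
Proof.
assert (B : is_basis slit_disc (holomorphic_solution k) (k + 2) (varpi k))
  by (apply varpi_basis; lia).
split; [|split; [exists (varpi k); exact B|exact B]].
intros z Hz; split; apply pseries_sum_correct; trivial.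
- apply tempered_coef0.
- apply tempered_coef1.
Qed.
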